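(* Let $\mathcal H$ be a separable infinite-dimensional Hilbert space, and let $\{g_k\}_{k=1}^\infty$ be a frame for $\mathcal H$ of the form $\{g_k\}_{k=1}^\infty=\{g_k\}_{k=1}^N\cup\{g_k\}_{k=N+1}^\infty$, where $N\in\mathbb N$ and $\{g_k\}_{k=N+1}^\infty$ is a Riesz basis for $\mathcal H$. Then, given any $\delta>0$, there exists a Riesz basis $\{\psi_k\}_{k=1}^\infty$ for $\mathcal H$ such that $\|g_k-\psi_k\|\le\delta$ for all $k\in\mathbb N$.
   Context: Hilbert spaces are over $\mathbb C$, and $\mathbb N=\{1,2,3,\dots\}$. A sequence $\{g_k\}_{k=1}^\infty$ in $\mathcal H$ is a frame for $\mathcal H$ if there are constants $A,B>0$ with $A\|f\|^2\le\sum_{k=1}^\infty|\langle f,g_k\rangle|^2\le B\|f\|^2$ for all $f\in\mathcal H$. A Riesz basis for $\mathcal H$ is a frame for $\mathcal H$ that is also a (Schauder) basis for $\mathcal H$; equivalently, it is the image of an orthonormal basis of $\mathcal H$ under a bounded bijective operator $\mathcal H\to\mathcal H$. *)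

(* Defs.v *)
From HB Require Import structures.
From mathcomp Require Import all_boot all_order all_algebra.
From mathcomp Require Import complex.
From mathcomp Require Import all_classical all_reals all_analysis.

Set Implicit Arguments.
Unset Strict Implicit.
Unset Printing Implicit Defensive.

Import Order.TTheory GRing.Theory Num.Theory.
Import numFieldNormedType.Exports.

Local Open Scope classical_set_scope.
Local Open Scope complex_scope.
Local Open Scope ring_scope.

(** Sequences indexed by k = 1, 2, 3, ... are functions on [nat] shifted by one:
    [u k] stands for the mathematical term of index [k.+1]. *)

(** A complex Hilbert space is a complete normed module over [R[i]] with a
    positive definite hermitian form (linear in the first argument) inducing the
    norm. *)
Definition inner_norm (R : realType) (H : normedModType R[i])
    (dot : {dot H for Num.conj}) : Prop :=
  forall x : H, `|x| ^+ 2 = dot x x.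

(** Norms of modules over [R[i]] take values in [R[i]], on the nonnegative real
    axis; [rnorm] is the same value in [R]. *)
Definition rnorm (R : realType) (V : normedZmodType R[i]) (x : V) : R :=
  complex.Re `|x|.

Definition separable (T : topologicalType) : Prop :=
  exists2 D : set T, countable D & dense D.

Definition finite_dimensional (K : fieldType) (V : lmodType K) : Prop :=
  exists (n : nat) (e : 'I_n -> V),
    forall x : V, exists c : 'I_n -> K, x = \sum_(i < n) c i *: e i.

(** The sum is taken in [\bar R], so the upper bound includes its finiteness. *)
Definition frame (R : realType) (H : normedModType R[i])
    (dot : {dot H for Num.conj}) (g : nat -> H) : Prop :=
  exists A B : R, [/\ 0 < A, 0 < B & forall f : H,
    ((A * rnorm f ^+ 2)%:E <= \sum_(0 <= k <oo) (rnorm (dot f (g k)) ^+ 2)%:E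
       <= (B * rnorm f ^+ 2)%:E)%E].

Definition schauder_basis (K : numFieldType) (V : normedModType K)
    (e : nat -> V) : Prop :=
  forall f : V, exists! c : nat -> K,
    series (fun k => c k *: e k) @ \oo --> f.

Definition riesz_basis (R : realType) (H : normedModType R[i])
    (dot : {dot H for Num.conj}) (g : nat -> H) : Prop :=
  frame dot g /\ schauder_basis g.

(* Main.v *)
(** Only the tail of the sequence matters, and by induction on [N] it suffices
    to put one vector [f] in front of a Riesz basis [e]. Fix [q, r > 0] with
    [q^2 + r^2 = 1] and [q] small, and put [s_k = q * sum_m r^m e_(k+m)], so that
    [s_k = q e_k + r s_(k+1)]. When [e] is orthonormal, [(s_k, psi_k)] with
    [psi_k = r e_k - q s_(k+1)] is a rotation of the orthonormal pair
    [(e_k, s_(k+1))]; hence [s_0, psi_0, psi_1, ...] is orthonormal, and it spans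
    the same space as [e] because [e_k] and [s_(k+1)] are recovered from [s_k]
    and [psi_k]. (In the Hardy space model, [psi_k] is [z^k] times the Blaschke
    factor [(r - z) / (1 - r z)].) As [q] tends to [0], [psi_k] tends to [e_k]
    uniformly in [k], although the operator [e_k |-> psi_k] has index [-1]. The
    same recursion acts on coefficients for any Riesz basis [e]. This frees the
    vector [s_0], which is then replaced by a vector close to [f] having a nonzero
    coefficient on it. *)

Require Import Defs.
From HB Require Import structures.
From mathcomp Require Import all_boot all_order all_algebra.
From mathcomp Require Import complex.
From mathcomp Require Import all_classical all_reals all_analysis.
From mathcomp Require Import ring lra.

Set Implicit Arguments.
Unset Strict Implicit.
Unset Printing Implicit Defensive.

Import Order.TTheory GRing.Theory Num.Theory.
Import numFieldNormedType.Exports.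

Local Open Scope classical_set_scope.
Local Open Scope complex_scope.
Local Open Scope ring_scope.

(** * Padding and shifting of finite sums *)

Lemma sum_pad (V : zmodType) (F : nat -> V) m n : (m <= n)%N ->
  \sum_(0 <= k < n) (if (k < m)%N then F k else 0) = \sum_(0 <= k < m) F k.
Proof.
move=> mn; rewrite (@big_cat_nat _ _ _ m) //= [X in _ + X]big1_seq ?addr0.
  by apply: eq_big_nat => k /andP[_ ->].
by move=> k /andP[_]; rewrite mem_index_iota => /andP[mk _]; rewrite ltnNge mk.
Qed.

Lemma sum_shift (V : zmodType) (F : nat -> V) n m :
  \sum_(n <= k < n + m) F k = \sum_(0 <= j < m) F (n + j)%N.
Proof.
rewrite -{1}[n]add0n big_addn addKn.
by apply: eq_bigr => j _; rewrite addnC.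
Qed.

(** * The real-valued norm and convergence *)

Section RealNorm.
Variables (R : realType) (V : normedModType R[i]).
Implicit Types (x y : V) (a : R[i]).

Lemma normr_rnorm x : `|x| = (rnorm x)%:C.
Proof. by rewrite RRe_real ?ger0_real. Qed.

Lemma rnorm_ge0 x : 0 <= rnorm x.
Proof. by rewrite -lecR -normr_rnorm normr_ge0. Qed.

Lemma rnorm0 : rnorm (0 : V) = 0.
Proof. by rewrite /rnorm normr0. Qed.

Lemma rnormD x y : rnorm (x + y) <= rnorm x + rnorm y.
Proof. by rewrite -lecR rmorphD /= -!normr_rnorm ler_normD. Qed.

Lemma rnormN x : rnorm (- x) = rnorm x.
Proof. by rewrite /rnorm normrN. Qed.

Lemma rnormBC x y : rnorm (x - y) = rnorm (y - x).
Proof. by rewrite /rnorm distrC. Qed.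

Lemma rnormZ a x : rnorm (a *: x) = rnorm a * rnorm x.
Proof.
by apply: complexI; rewrite rmorphM /= -!normr_rnorm normrZ; congr (_ * _);
  rewrite RRe_real ?ger0_real.
Qed.

Lemma rnormZr (r : R) x : 0 <= r -> rnorm (r%:C *: x) = r * rnorm x.
Proof.
by move=> r0; rewrite rnormZ /rnorm ger0_norm // lecR.
Qed.

Lemma rnorm_le0 x : rnorm x <= 0 -> x = 0.
Proof.
move=> x0; apply/eqP; rewrite -normr_eq0 normr_rnorm.
by rewrite (_ : rnorm _ = 0) //; apply/eqP; rewrite eq_le x0 rnorm_ge0.
Qed.

Lemma rnorm_sqrD_le x y :
  rnorm (x + y) ^+ 2 <= 2 * rnorm x ^+ 2 + 2 * rnorm y ^+ 2.
Proof.
apply: (@le_trans _ _ ((rnorm x + rnorm y) ^+ 2)).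
  by rewrite ler_pXn2r ?nnegrE ?addr_ge0 ?rnorm_ge0 // rnormD.
by have := sqr_ge0 (rnorm x - rnorm y); nra.
Qed.

Lemma rnorm_sum (u : nat -> V) m n :
  rnorm (\sum_(m <= k < n) u k) <= \sum_(m <= k < n) rnorm (u k).
Proof.
elim/big_ind2: _ => [|x1 x2 y1 y2 h1 h2|//]; first by rewrite rnorm0.
exact: le_trans (rnormD _ _) (lerD h1 h2).
Qed.

(** A positive element of [R[i]] is real, so the radii of the [R[i]]-valued norm and those of [R]
    correspond through [%:C]. *)
Lemma cvgn_rnormP (u : nat -> V) x :
  u @ \oo --> x <-> (rnorm (x - u n) @[n --> \oo] --> (0 : R)).
Proof.
split=> [/cvgrPdist_lt ux|/cvgrPdist_lt ux]; apply/cvgrPdist_lt => e e0.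
  have /ux : 0 < e%:C by rewrite ltcR.
  apply: filterS => n; rewrite normr_rnorm ltcR => H.
  by rewrite sub0r normrN ger0_norm // rnorm_ge0.
have eR : e = (complex.Re e)%:C by rewrite RRe_real // gtr0_real.
move: e0; rewrite eR ltcR => /ux.
apply: filterS => n; rewrite sub0r normrN ger0_norm ?rnorm_ge0 // => H.
by rewrite normr_rnorm ltcR.
Qed.

Lemma cvgn_rnorm (u : nat -> V) x :
  u @ \oo --> x -> (rnorm (u n) @[n --> \oo] --> rnorm x).
Proof.
move=> /cvgn_rnormP ux; apply/subr_cvg0.
apply: (@squeeze_cvgr _ _ _ _ (fun n => - rnorm (x - u n)) (fun n => rnorm (x - u n))).
- near=> n.
  have := rnormD (x - u n) (u n); have := rnormD (u n - x) x.
  rewrite !subrK (rnormBC (u n)).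
  by move=> h1 h2; apply/andP; split; lra.
- by rewrite -oppr0; apply: cvgN.
- exact: ux.
Unshelve. all: by end_near. Qed.

End RealNorm.

(** Cauchy criterion. The exponent covers two uses: squares ([p = 1]) for sums controlled by
    square-summable coefficients, and the norm itself ([p = 0]) for comparison with a geometric
    series. *)
Lemma cvgn_series_dominated (R : realType) (V : completeNormedModType R[i])
    (u : nat -> V) (p : nat) (a : nat -> R) :
  (forall m n, rnorm (\sum_(m <= k < n) u k) ^+ p.+1 <= \sum_(m <= k < n) a k) ->
  cvgn (series a) -> cvgn (series u).
Proof.
move=> ua /cauchy_cvgP/cauchy_seriesP ca; apply/cauchy_cvgP/cauchy_seriesP => e e0.
have eR : e = (complex.Re e)%:C by rewrite RRe_real // gtr0_real.
move: e0; rewrite eR ltcR => e0.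
have /ca : 0 < complex.Re e ^+ p.+1 by rewrite exprn_gt0.
apply: filterS => -[m n] /= H; rewrite normr_rnorm ltcR.
rewrite -(@ltr_pXn2r _ p.+1) ?nnegrE ?rnorm_ge0 ?(ltW e0) //.
exact: le_lt_trans (ua m n) (le_lt_trans (ler_norm _) H).
Qed.

(** * Real parts of inner products *)

Section InnerProduct.
Variables (R : realType) (H : normedModType R[i]) (dot : {dot H for Num.conj}).
Hypothesis dot_norm : inner_norm dot.
Implicit Types x y : H.

Lemma dotxx x : dot x x = (rnorm x ^+ 2)%:C.
Proof. by rewrite -dot_norm normr_rnorm rmorphXn. Qed.

Lemma Re_dotC x y : complex.Re (dot y x) = complex.Re (dot x y).
Proof.
by rewrite hermC /= expr0 mul1r; case: (dot x y).
Qed.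

Lemma rnorm_dotC x y : rnorm (dot y x) = rnorm (dot x y).
Proof. by rewrite /rnorm hermC expr0 mul1r norm_conjC. Qed.

Lemma rnorm_subsqr x y :
  rnorm (x - y) ^+ 2 = rnorm x ^+ 2 + rnorm y ^+ 2 - 2 * complex.Re (dot x y).
Proof.
have := dotxx (x - y); rewrite linearBl !linearBr /= !dotxx => /(congr1 (@complex.Re _)).
rewrite /= => <-; rewrite raddfB /= raddfB /= raddfB /= (Re_dotC x y).
ring.
Qed.

Lemma Re_dotZl (r : R) x y : complex.Re (dot (r%:C *: x) y) = r * complex.Re (dot x y).
Proof.
have -> : dot (r%:C *: x) y = r%:C * dot x y by exact: linearZl_LR.
by case: (dot x y) => a b /=; rewrite mul0r subr0.
Qed.

Lemma Re_dot_suml (c : nat -> R[i]) (g : nat -> H) m n y :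
  complex.Re (dot (\sum_(m <= k < n) c k *: g k) y) =
  \sum_(m <= k < n) complex.Re (c k * dot (g k) y).
Proof.
rewrite linear_sumlz raddf_sum; apply: eq_bigr => k _.
by congr complex.Re; exact: linearZl_LR.
Qed.

(** Expand [0 <= rnorm (l%:C *: x - y) ^+ 2] and divide by [l]. This weighted AM-GM bound does the
    work of Cauchy-Schwarz: the weight is chosen so that one term on the right can be absorbed. *)
Lemma Re_dot_le (l : R) x y : 0 < l ->
  2 * complex.Re (dot x y) <= l * rnorm x ^+ 2 + l^-1 * rnorm y ^+ 2.
Proof.
move=> l0; have := sqr_ge0 (rnorm (l%:C *: x - y)).
rewrite rnorm_subsqr rnormZr ?(ltW l0) //.
rewrite Re_dotZl.
move=> h; rewrite -subr_ge0.
set N2 := 2 * _; set M := complex.Re _ in h N2 *.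
have -> : l * rnorm x ^+ 2 + l^-1 * rnorm y ^+ 2 - N2 =
  l^-1 * ((l * rnorm x) ^+ 2 + rnorm y ^+ 2 - 2 * (l * M)).
  by rewrite /N2; field; rewrite gt_eqF.
by rewrite mulr_ge0 // invr_ge0 ltW.
Qed.

End InnerProduct.

(** * The same estimates for complex scalars *)

Section ComplexReal.
Variable R : realType.
Implicit Types a b : R[i].

Lemma rnorm_sqrC a : rnorm a ^+ 2 = complex.Re a ^+ 2 + complex.Im a ^+ 2.
Proof.
by apply: complexI; rewrite add_Re2_Im2 rmorphXn /= RRe_real ?ger0_real.
Qed.

Lemma rnormM a b : rnorm (a * b) = rnorm a * rnorm b.
Proof.
by apply: complexI; rewrite rmorphM /= !RRe_real ?ger0_real // normrM.
Qed.

Lemma Re_mul_conj a : complex.Re (a * Num.conj a) = rnorm a ^+ 2.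
Proof. by rewrite -normCK -add_Re2_Im2 rnorm_sqrC. Qed.

Lemma rnorm_real (r : R) : 0 <= r -> rnorm r%:C = r.
Proof. by move=> r0; rewrite /rnorm ger0_norm ?lecR. Qed.

Lemma Re_mul_le (l : R) a b : 0 < l ->
  2 * complex.Re (a * b) <= l * rnorm a ^+ 2 + l^-1 * rnorm b ^+ 2.
Proof.
move=> l0; rewrite !rnorm_sqrC; case: a b => [a1 a2] [b1 b2] /=.
rewrite -subr_ge0.
have -> : l * (a1 ^+ 2 + a2 ^+ 2) + l^-1 * (b1 ^+ 2 + b2 ^+ 2) -
    2 * (a1 * b1 - a2 * b2) =
  l^-1 * ((l * a1 - b1) ^+ 2 + (l * a2 + b2) ^+ 2).
  by field; rewrite gt_eqF.
by rewrite mulr_ge0 ?invr_ge0 ?(ltW l0) // addr_ge0 // sqr_ge0.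
Qed.

Lemma rnormC_sqrD_le a b : rnorm (a + b) ^+ 2 <= 2 * rnorm a ^+ 2 + 2 * rnorm b ^+ 2.
Proof.
rewrite !rnorm_sqrC; case: a b => [a1 a2] [b1 b2] /=.
by have := sqr_ge0 (a1 - b1); have := sqr_ge0 (a2 - b2); nra.
Qed.

Lemma rnorm_sqr_eq0 a : rnorm a ^+ 2 = 0 -> a = 0.
Proof.
move=> /eqP; rewrite sqrf_eq0 => /eqP a0; apply/eqP; rewrite -normr_eq0.
by rewrite -[`|_|](RRe_real (ger0_real (normr_ge0 _))) -/(rnorm _) a0.
Qed.

End ComplexReal.

(** * Frames and Riesz bases *)

Section Frames.
Variables (R : realType) (H : completeNormedModType R[i]).
Variable dot : {dot H for Num.conj}.
Hypothesis dot_norm : inner_norm dot.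
Implicit Types (g : nat -> H) (c : nat -> R[i]) (A B : R).

Definition frame_coef g (f : H) (k : nat) : R := rnorm (dot f (g k)) ^+ 2.

Lemma frame_coef_ge0 g f k : 0 <= frame_coef g f k.
Proof. exact: sqr_ge0. Qed.

Lemma frameP g : frame dot g <-> exists A B : R, [/\ 0 < A, A <= B &
  forall f, exists G : R, [/\ series (frame_coef g f) @ \oo --> G,
    A * rnorm f ^+ 2 <= G & G <= B * rnorm f ^+ 2]].
Proof.
split=> [[A [B [A0 B0 AB]]]|[A [B [A0 AB hf]]]].
  exists A, (Num.max A B); split=> [//||f]; first by rewrite le_max lexx.
  pose s : \bar R := (\sum_(0 <= k <oo) (frame_coef g f k)%:E)%E.
  have /andP[sA sB] : ((A * rnorm f ^+ 2)%:E <= s <= (B * rnorm f ^+ 2)%:E)%E := AB f.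
  have sfin : s \is a fin_num.
    by rewrite ge0_fin_numE ?(le_lt_trans sB) ?ltry // nneseries_ge0 // => k _ _;
      rewrite lee_fin frame_coef_ge0.
  exists (fine s); split.
  - have : (fun n => (\sum_(0 <= k < n) (frame_coef g f k)%:E)%E) @ \oo --> s.
      by apply: is_cvg_nneseries => k _ _; rewrite lee_fin frame_coef_ge0.
    rewrite -(fineK sfin) => /fine_cvgP[_].
    apply: cvg_trans; apply: near_eq_cvg; apply: nearW => n /=.
    by rewrite sumEFin.
  - by rewrite -lee_fin fineK.
  - rewrite -lee_fin fineK // (le_trans sB) // lee_fin ler_wpM2r ?sqr_ge0 //.
    by rewrite le_max lexx orbT.
exists A, B; split=> [//||f]; first exact: lt_le_trans AB.
have [G [cG AG BG]] := hf f.
have -> : (\sum_(0 <= k <oo) (rnorm (dot f (g k)) ^+ 2)%:E)%E = G%:E.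
  apply: cvg_lim => //; apply/fine_cvgP; split.
    by apply: nearW => n; rewrite sumEFin.
  move: cG; apply: cvg_trans; apply: near_eq_cvg; apply: nearW => n /=.
  by rewrite sumEFin.
by rewrite !lee_fin AG BG.
Qed.

Lemma sum_frame_coef_le g f G m n : series (frame_coef g f) @ \oo --> G ->
  \sum_(m <= k < n) frame_coef g f k <= G.
Proof.
move=> cG; have nd : nondecreasing_seq (series (frame_coef g f)).
  by apply: nondecreasing_series => k _ _; exact: frame_coef_ge0.
have := nondecreasing_cvgn_le nd (cvgP _ cG) n; rewrite (cvg_lim _ cG) //.
apply: le_trans; rewrite /series /=; have [mn|nm] := leqP m n.
  rewrite [leRHS](@big_cat_nat _ _ _ m) //= lerDr.
  by apply: sumr_ge0 => k _; exact: frame_coef_ge0.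
by rewrite big_geq ?(ltnW nm) //; apply: sumr_ge0 => k _; exact: frame_coef_ge0.
Qed.

Lemma bessel_synthesis g B : 0 < B ->
  (forall f m n, \sum_(m <= k < n) frame_coef g f k <= B * rnorm f ^+ 2) ->
  forall c m n, rnorm (\sum_(m <= k < n) c k *: g k) ^+ 2 <=
    B * \sum_(m <= k < n) rnorm (c k) ^+ 2.
Proof.
move=> B0 hB c m n; set X := \sum_(m <= k < n) _.
(* AM-GM with weight [B] on each term of [<X, X>] avoids Cauchy-Schwarz. *)
have : 2 * rnorm X ^+ 2 <= \sum_(m <= k < n)
    (B * rnorm (c k) ^+ 2 + B^-1 * frame_coef g X k).
  have -> : rnorm X ^+ 2 = complex.Re (dot X X) by rewrite dotxx.
  rewrite {1}/X Re_dot_suml mulr_sumr; apply: ler_sum => k _.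
  rewrite /frame_coef (rnorm_dotC dot (g k)).
  exact: Re_mul_le.
rewrite big_split /= -!mulr_sumr => h.
(* The Bessel bound for [X] itself absorbs this sum into one of the two copies of [rnorm X ^+ 2]. *)
have : B^-1 * \sum_(m <= k < n) frame_coef g X k <= rnorm X ^+ 2.
  by rewrite ler_pdivrMl.
by lra.
Qed.

Lemma Re_dot_synthesis g f m n :
  complex.Re (dot (\sum_(m <= k < n) dot f (g k) *: g k) f) =
  \sum_(m <= k < n) frame_coef g f k.
Proof.
rewrite Re_dot_suml; apply: eq_bigr => k _.
by rewrite (hermC _ (g k)) expr0 mul1r; exact: Re_mul_conj.
Qed.

Lemma frame_expansion g : frame dot g ->
  forall F : H, exists h : H, series (fun k => dot h (g k) *: g k) @ \oo --> F.
Proof.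
(* With [S] the frame operator, the iteration [x := x + (F - S x) / B] converges
   to a solution of [S h = F], because [|f - S f / B|^2 <= (1 - A / B) |f|^2]. *)
move=> /frameP[A [B [A0 AB hf]]] F.
have B0 : 0 < B := lt_le_trans A0 AB.
have bess f m n : \sum_(m <= k < n) frame_coef g f k <= B * rnorm f ^+ 2.
  have [G [cG _ GB]] := hf f.
  exact: le_trans (sum_frame_coef_le m n cG) GB.
pose S f := limn (series (fun k => dot f (g k) *: g k)).
have cS f : series (fun k => dot f (g k) *: g k) @ \oo --> S f.
  suff: cvgn (series (fun k => dot f (g k) *: g k)) by [].
  apply: (@cvgn_series_dominated _ _ _ 1 (fun k => B * frame_coef g f k)).
    by move=> m n; rewrite -mulr_sumr; exact: bessel_synthesis.
  have [G [cG _ _]] := hf f.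
  apply: (cvgP (B * G)); rewrite (_ : series _ = (fun n => B * series (frame_coef g f) n)).
    by apply: cvgMr.
  by apply: funext => n; rewrite /series /= mulr_sumr.
have SB x y : S (x - y) = S x - S y.
  have c := cvgB (cS x) (cS y); rewrite {1}/S -[RHS](cvg_lim (@norm_hausdorff _ H) (c _)).
  congr (limn _); apply: funext => n; rewrite !fctE /series /= -sumrB.
  by apply: eq_bigr => k _; rewrite linearBl scalerBl.
have Sle x : rnorm (S x) <= B * rnorm x.
  apply: (cvgr_to_le (cvgn_rnorm (cS x))); apply: nearW => n.
  rewrite -(@ler_pXn2r _ 2) ?nnegrE ?rnorm_ge0 ?mulr_ge0 ?rnorm_ge0 ?(ltW B0) //.
  apply: le_trans (bessel_synthesis B0 bess _ _ _) _.
  by rewrite exprMn expr2 -mulrA ler_wpM2l ?(ltW B0) //; exact: bess.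
pose q := 1 - A / B.
have q0 : 0 <= q by rewrite subr_ge0 ler_pdivrMr ?mul1r.
have q1 : q < 1 by rewrite gtrBl divr_gt0.
(* For the partial sums [X] of [S f], with coefficient sum [G_n], the cross term contributes
   [- 2 G_n / B] and [rnorm X ^+ 2 / B ^+ 2] is at most [G_n / B]. In the limit,
   [rnorm f ^+ 2 - G / B] remains, and [G >= A * rnorm f ^+ 2]. *)
have contr f : rnorm (f - B^-1%:C *: S f) ^+ 2 <= q * rnorm f ^+ 2.
  have [G [cG AG _]] := hf f.
  have c1 : (rnorm (f - B^-1%:C *: series (fun k => dot f (g k) *: g k) n) ^+ 2
      @[n --> \oo] --> rnorm (f - B^-1%:C *: S f) ^+ 2).
    have c : (f - B^-1%:C *: series (fun k => dot f (g k) *: g k) n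
        @[n --> \oo] --> f - B^-1%:C *: S f).
      by apply: cvgB; [exact: cvg_cst|apply: cvgZr; exact: cS].
    rewrite expr2; under eq_cvg do rewrite expr2.
    by apply: cvgM; exact: cvgn_rnorm c.
  have c2 : (rnorm f ^+ 2 - B^-1 * series (frame_coef g f) n @[n --> \oo]
      --> rnorm f ^+ 2 - B^-1 * G).
    by apply: cvgB; [exact: cvg_cst|exact: cvgMr].
  apply: (@le_trans _ _ (rnorm f ^+ 2 - B^-1 * G)).
    apply: (ler_cvg_to c1 c2); apply: nearW => n.
    set X := series _ n.
    rewrite rnormBC (rnorm_subsqr dot_norm) rnormZr ?invr_ge0 ?(ltW B0) //.
    rewrite Re_dotZl.
    have -> : complex.Re (dot X f) = series (frame_coef g f) n.
      exact: Re_dot_synthesis.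
    have : rnorm X ^+ 2 <= B * series (frame_coef g f) n.
      exact: bessel_synthesis.
    move/(ler_wpM2l (sqr_ge0 B^-1)).
    have -> : B^-1 ^+ 2 * (B * series (frame_coef g f) n) =
        B^-1 * series (frame_coef g f) n by field; rewrite gt_eqF.
    rewrite exprMn; lra.
  rewrite /q mulrBl mul1r lerD2l lerN2 mulrAC (mulrC B^-1) ler_pM2r ?invr_gt0 //.
pose x := fix x n := if n is m.+1 then x m + B^-1%:C *: (F - S (x m)) else 0 : H.
pose d n := x n.+1 - x n.
have dE n : d n = B^-1%:C *: (F - S (x n)) by rewrite /d /= addrC addKr.
(* The increments are iterates of the contraction; [contr] bounds squares, hence the ratio
   [Num.sqrt q] below. *)
have dS n : d n.+1 = d n - B^-1%:C *: S (d n).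
  rewrite [S (d n)]SB !dE -scalerBr; congr (_ *: _).
  by rewrite opprB addrA subrK.
have dle n : rnorm (d n) <= Num.sqrt q ^+ n * rnorm (d 0%N).
  elim: n => [|n IH]; first by rewrite expr0 mul1r.
  rewrite exprS -mulrA; apply: le_trans (ler_wpM2l (sqrtr_ge0 q) IH).
  rewrite -(@ler_pXn2r _ 2) ?nnegrE ?mulr_ge0 ?rnorm_ge0 ?sqrtr_ge0 //.
  by rewrite exprMn sqr_sqrtr // dS contr.
have sq1 : `|Num.sqrt q| < 1.
  by rewrite ger0_norm ?sqrtr_ge0 // -sqrtr1 ltr_sqrt.
have cd : cvgn (series d).
  apply: (@cvgn_series_dominated _ _ _ 0 (geometric (rnorm (d 0%N)) (Num.sqrt q))).
    move=> m n; rewrite expr1; apply: le_trans (rnorm_sum _ _ _) _.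
    by apply: ler_sum => k _; rewrite /geometric /= mulrC.
  exact: is_cvg_geometric_series.
exists (limn (series d)); set h := limn _.
have -> // : F = S h.
have xE n : series d n = x n by rewrite /series /= telescope_sumr // subr0.
have d0 : (rnorm (d n) @[n --> \oo] --> (0 : R)).
  apply: (@squeeze_cvgr _ _ _ _ (fun=> 0) (geometric (rnorm (d 0%N)) (Num.sqrt q))).
  - by apply: nearW => n; rewrite rnorm_ge0 /geometric /= mulrC.
  - exact: cvg_cst.
  - exact: cvg_geometric.
have : (B * rnorm (d n) + B * rnorm (h - series d n) @[n --> \oo] --> (0 : R)).
  rewrite (_ : 0 = B * 0 + B * 0 :> R); last by rewrite !mulr0 addr0.
  by apply: cvgD; apply: cvgMr => //; apply/cvgn_rnormP.
(* The residual splits into that of the [n]-th iterate, which is [B] times its increment, and the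
   image under [S] of its error; both tend to 0. *)
move=> c0; have : rnorm (F - S h) <= 0.
  apply: (cvgr_to_ge c0); apply: nearW => n.
  have -> : F - S h = B%:C *: d n - S (h - series d n).
    rewrite SB dE scalerA -rmorphM /= divff ?gt_eqF // scale1r xE.
    by rewrite opprB addrA subrK.
  apply: le_trans (rnormD _ _) _; rewrite rnormN rnormZr ?(ltW B0) //.
  by rewrite lerD2l Sle.
by move=> /rnorm_le0/subr0_eq.
Qed.

(** Together with completeness, these bounds characterise Riesz bases. They involve only finite
    combinations, so they can be followed through the changes of basis below. *)
Definition riesz_sequence g := exists al be : R, [/\ 0 < al, 0 < be &
  forall n c, al * \sum_(0 <= k < n) rnorm (c k) ^+ 2 <=
    rnorm (\sum_(0 <= k < n) c k *: g k) ^+ 2 <=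
    be * \sum_(0 <= k < n) rnorm (c k) ^+ 2].

Definition complete_sequence g := forall (f : H) (e : R), 0 < e ->
  exists n c, rnorm (f - \sum_(0 <= k < n) c k *: g k) <= e.

(** The upper bound is the Bessel bound. For the lower one, write [F = S h] with [S] the frame
    operator: uniqueness of expansions forces the coefficients of [F] to be [dot h (g k)], whose
    squares sum to at most [A^-1 * rnorm F ^+ 2]. *)
Lemma riesz_basis_sequence g :
  riesz_basis dot g -> riesz_sequence g /\ complete_sequence g.
Proof.
move=> [gf gs]; split; last first.
  move=> f e e0; have [c [cf _]] := gs f.
  move/cvgn_rnormP/cvgrPdist_le: cf => /(_ _ e0)[n _ /(_ n (leqnn n))] /=.
  rewrite sub0r normrN ger0_norm ?rnorm_ge0 // => h.
  by exists n, c.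
have /frameP[A [B [A0 AB hf]]] := gf.
have B0 : 0 < B := lt_le_trans A0 AB.
exists A, B; split=> // n c; apply/andP; split; last first.
  apply: bessel_synthesis => // f m n'.
  have [G [cG _ GB]] := hf f.
  exact: le_trans (sum_frame_coef_le m n' cG) GB.
set F := \sum_(0 <= k < n) c k *: g k.
have [h hF] := frame_expansion gf F.
have [G [cG AG _]] := hf h.
(* [G] is the limit of the real parts of the inner products of the partial sums of [F] with [h].
   With weight [A^-1], the term [A * rnorm h ^+ 2] is at most [G], which leaves
   [G <= A^-1 * rnorm F ^+ 2]. *)
have GF : 2 * G <= A^-1 * rnorm F ^+ 2 + A * rnorm h ^+ 2.
  have c1 : (2 * series (frame_coef g h) n @[n --> \oo] --> 2 * G) by exact: cvgMr.
  have c2 : (A^-1 * rnorm (series (fun k => dot h (g k) *: g k) n) ^+ 2 +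
      A * rnorm h ^+ 2 @[n --> \oo] --> A^-1 * rnorm F ^+ 2 + A * rnorm h ^+ 2).
    apply: cvgD; last exact: cvg_cst.
    apply: cvgMr; rewrite expr2; under eq_cvg do rewrite expr2.
    by apply: cvgM; exact: cvgn_rnorm hF.
  apply: (ler_cvg_to c1 c2); apply: nearW => m.
  have Ai : 0 < A^-1 by rewrite invr_gt0.
  have := Re_dot_le dot_norm (series (fun k => dot h (g k) *: g k) m) h Ai.
  by rewrite invrK /series /= Re_dot_synthesis.
have cE k : (k < n)%N -> c k = dot h (g k).
  move=> kn; have [c' [_ uc]] := gs F.
  have /(congr1 (@^~ k)) <- := uc _ hF.
  (* Extended by zeros, [c] gives a second expansion of [F]. *)
  pose c0 j := if (j < n)%N then c j else 0.
  have /uc -> : series (fun j => c0 j *: g j) @ \oo --> F.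
    apply: cvg_near_cst; exists n => // m /= nm.
    rewrite /F -(sum_pad _ nm); apply: eq_bigr => j _; rewrite /c0.
    by case: ifP => // _; rewrite scale0r.
  by rewrite /c0 kn.
have -> : \sum_(0 <= k < n) rnorm (c k) ^+ 2 = \sum_(0 <= k < n) frame_coef g h k.
  by apply: eq_big_nat => k /andP[_ kn]; rewrite cE.
have : A * \sum_(0 <= k < n) frame_coef g h k <= A * G.
  by rewrite ler_pM2l // sum_frame_coef_le.
move/le_trans; apply.
rewrite -(@ler_pM2l _ A^-1) ?invr_gt0 // mulKf ?gt_eqF //.
lra.
Qed.

Lemma riesz_sequence_basis g :
  riesz_sequence g -> complete_sequence g -> riesz_basis dot g.
Proof.
move=> [al [be [al0 be0 gr]]] gc.
have gfr : frame dot g.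
  (* Already [be] is an upper bound; adding [al] secures the ordering of the bounds that [frameP]
     requires. The factor 3/4 comes from approximating [f] within half its norm. *)
  apply/frameP; exists (3 / 4 * al), (be + al); split; [lra|lra|] => f.
  have ub n : series (frame_coef g f) n <= be * rnorm f ^+ 2.
    rewrite /series /=; set s := \sum_(0 <= k < n) _.
    pose X := \sum_(0 <= k < n) dot f (g k) *: g k.
    have h1 : 2 * s <= be^-1 * rnorm X ^+ 2 + be * rnorm f ^+ 2.
      have bi : 0 < be^-1 by rewrite invr_gt0.
      by have := Re_dot_le dot_norm X f bi; rewrite invrK Re_dot_synthesis.
    have : be^-1 * rnorm X ^+ 2 <= s.
      by rewrite ler_pdivrMl //; have /andP[_] := gr n (fun k => dot f (g k)).
    by lra.
  have nd : nondecreasing_seq (series (frame_coef g f)).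
    by apply: nondecreasing_series => k _ _; exact: frame_coef_ge0.
  have cG : cvgn (series (frame_coef g f)).
    by apply: nondecreasing_is_cvgn => //; exists (be * rnorm f ^+ 2) => _ [n _ <-].
  exists (limn (series (frame_coef g f))); set G := limn _; split=> //; last first.
    apply: (cvgr_to_le cG); apply: nearW => n; apply: le_trans (ub n) _.
    by rewrite ler_wpM2r ?sqr_ge0 // lerDl ltW.
  have [f0|f0] := eqVneq (rnorm f) 0.
    rewrite f0 expr0n /= mulr0; apply: (cvgr_to_ge cG); apply: nearW => n.
    by apply: sumr_ge0 => k _; exact: frame_coef_ge0.
  (* For this approximant [F], expanding [rnorm (f - F) ^+ 2 <= rnorm f ^+ 2 / 4] leaves a cross
     term. It is at most [rnorm F ^+ 2 + al^-1 * G], by AM-GM with weight [al] and the lower Riesz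
     bound. *)
  have /gc-/(_ f)[n [c]] : 0 < rnorm f / 2 by rewrite divr_gt0 // lt_def f0 rnorm_ge0.
  set F := \sum_(0 <= k < n) _ => fF.
  have : rnorm (f - F) ^+ 2 <= rnorm f ^+ 2 / 4.
    rewrite (_ : _ / 4 = (rnorm f / 2) ^+ 2); last by field.
    by rewrite ler_pXn2r ?nnegrE ?rnorm_ge0 // divr_ge0 ?rnorm_ge0.
  rewrite (rnorm_subsqr dot_norm) -Re_dotC.
  have : 2 * complex.Re (dot F f) <= \sum_(0 <= k < n)
      (al * rnorm (c k) ^+ 2 + al^-1 * frame_coef g f k).
    rewrite /F Re_dot_suml mulr_sumr; apply: ler_sum => k _.
    by rewrite /frame_coef -(rnorm_dotC dot f); exact: Re_mul_le.
  rewrite big_split /= -!mulr_sumr.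
  have /andP[+ _] := gr n c.
  have : al^-1 * \sum_(0 <= k < n) frame_coef g f k <= al^-1 * G.
    by rewrite ler_pM2l ?invr_gt0 // sum_frame_coef_le.
  rewrite -/F => h1 h2 h3 h4.
  have : 3 / 4 * rnorm f ^+ 2 <= al^-1 * G by lra.
  by rewrite ler_pdivlMl // mulrA (mulrC al).
split=> // f; have [h hf] := frame_expansion gfr f.
exists (fun k => dot h (g k)); split=> // c cf; apply: funext => k.
have : rnorm (series (fun k => dot h (g k) *: g k) n - series (fun k => c k *: g k) n) ^+ 2
    @[n --> \oo] --> (0 : R).
  have c0 : (series (fun k => dot h (g k) *: g k) n - series (fun k => c k *: g k) n)
      @[n --> \oo] --> (0 : H) by rewrite -(subrr f); apply: cvgB.
  have := cvgn_rnorm c0; rewrite rnorm0 => c1.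
  rewrite -(mulr0 0); under eq_cvg do rewrite expr2.
  exact: cvgM.
(* The lower Riesz bound applied to the difference of two expansions: once [n > k], the partial sum
   dominates the [k]-th term. *)
move=> c0; have : al * rnorm (dot h (g k) - c k) ^+ 2 <= 0.
  apply: (cvgr_to_ge c0); exists k.+1 => // n /= kn.
  rewrite /series /= -sumrB; under eq_bigr do rewrite -scalerBl.
  have /andP[+ _] := gr n (fun k => dot h (g k) - c k).
  apply: le_trans; rewrite ler_pM2l //.
  rewrite big_mkord (bigD1 (Ordinal kn)) //= lerDl; apply: sumr_ge0 => j _.
  exact: sqr_ge0.
rewrite pmulr_rle0 // => le0; apply: subr0_eq; apply: rnorm_sqr_eq0.
by apply/eqP; rewrite eq_le le0 sqr_ge0.
Qed.

(** * Perturbation of Riesz sequences *)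

Definition in_span g (x : H) := exists n c, x = \sum_(0 <= k < n) c k *: g k.

Lemma in_spanZ g a x : in_span g x -> in_span g (a *: x).
Proof.
move=> [n [c ->]]; exists n, (fun k => a * c k); rewrite scaler_sumr.
by apply: eq_bigr => k _; rewrite scalerA.
Qed.

Lemma in_spanD g x y : in_span g x -> in_span g y -> in_span g (x + y).
Proof.
move=> [m [b ->]] [n [c ->]]; pose pad d p k : R[i] := if (k < p)%N then d k else 0.
have padE d p : (p <= m + n)%N ->
    \sum_(0 <= k < p) d k *: g k = \sum_(0 <= k < m + n) pad d p k *: g k.
  move=> /sum_pad <-; apply: eq_bigr => k _; rewrite /pad.
  by case: ifP => // _; rewrite scale0r.
exists (m + n)%N, (fun k => pad b m k + pad c n k).
rewrite (padE b) ?leq_addr // (padE c) ?leq_addl // -big_split /=.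
by apply: eq_bigr => k _; rewrite scalerDl.
Qed.

Lemma in_span_sum g (u : nat -> H) m n :
  (forall k, (m <= k < n)%N -> in_span g (u k)) -> in_span g (\sum_(m <= k < n) u k).
Proof.
move=> ug; rewrite big_nat_cond; elim/big_ind: _ => [|x y|k]; last first.
- by rewrite andbT => /ug.
- exact: in_spanD.
- by exists 0%N, (fun=> 0); rewrite big_geq.
Qed.

Lemma in_span_id g k : in_span g (g k).
Proof.
exists k.+1, (fun j => (j == k)%:R); rewrite big_nat_recr //= eqxx scale1r.
rewrite big1_seq ?add0r // => j /andP[_]; rewrite mem_index_iota => /andP[_ jk].
by rewrite ltn_eqF // scale0r.
Qed.

Lemma complete_sequence_span g phi : complete_sequence g ->
  (forall k, in_span phi (g k)) -> complete_sequence phi.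
Proof.
move=> gc gphi f e /(gc f)[n [c fc]].
have [m [d dE]] : in_span phi (\sum_(0 <= k < n) c k *: g k).
  by apply: in_span_sum => k _; exact: in_spanZ.
by exists m, d; rewrite -dE.
Qed.

(** Since [d 0] is nonzero, [phi 0] is recovered from the new vector and the other [phi k], which
    gives completeness. For the lower bound, [x] collects the coefficients in [phi] of a combination
    of [psi]; [x 0] controls [c 0], and then the other [c k] are controlled by subtracting
    [c 0 * d k]. *)
Lemma riesz_sequence_replace phi d n :
  riesz_sequence phi -> complete_sequence phi ->
  (forall k, (n <= k)%N -> d k = 0) -> d 0%N != 0 ->
  let psi k := if k is 0 then \sum_(0 <= j < n) d j *: phi j else phi k in
  riesz_sequence psi /\ complete_sequence psi.
Proof.
move=> [al [be [al0 be0 rs]]] phic dn d0 psi.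
pose y := \sum_(0 <= j < n) d j *: phi j.
have n0 : (0 < n)%N by rewrite lt0n; apply: contra_neq d0 => n0; rewrite dn // n0.
have rd0 : 0 < rnorm (d 0%N) ^+ 2.
  rewrite lt_def sqr_ge0 andbT; apply: contra d0 => /eqP.
  by move=> /rnorm_sqr_eq0 ->.
split; last first.
  apply: (complete_sequence_span phic) => -[|k]; last exact: (in_span_id psi k.+1).
  have -> : phi 0%N = (d 0%N)^-1 *: (psi 0%N + (-1) *: \sum_(1 <= j < n) d j *: phi j).
    by rewrite /= big_ltn // scaleN1r addrK scalerA mulVf // scale1r.
  apply: in_spanZ; apply: in_spanD; first exact: in_span_id.
  apply: in_spanZ; apply: in_span_sum => -[//|k] _.
  by apply: in_spanZ; exact: (in_span_id psi k.+1).
pose Y := \sum_(0 <= k < n) rnorm (d k) ^+ 2.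
have Y0 : 0 <= Y by apply: sumr_ge0 => k _; exact: sqr_ge0.
(* With [S] the sum of squares of [x], the sum for [c] is at most
   [2 * S + (1 + 2 * Y) * rnorm (c 0) ^+ 2], and [rnorm (c 0) ^+ 2 <= S / rnorm (d 0) ^+ 2]. *)
pose K := 2 + (1 + 2 * Y) / rnorm (d 0%N) ^+ 2.
have K0 : 0 < K by rewrite ltr_wpDr // divr_ge0 ?(ltW rd0) //; lra.
exists (al / K), (2 * rnorm y ^+ 2 + 2 * be); split; first exact: divr_gt0.
  by have := sqr_ge0 (rnorm y); lra.
move=> [|m] c; first by rewrite !big_geq // rnorm0 !mulr0 expr0n lexx.
pose b k : R[i] := if k is 0 then 0 else if (k <= m)%N then c k else 0.
have psiE : \sum_(0 <= k < m.+1) c k *: psi k =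
    c 0%N *: y + \sum_(0 <= k < m.+1) b k *: phi k.
  rewrite !big_nat_recl //= scale0r add0r; congr (_ + _).
  by apply: eq_big_nat => k /andP[_ km]; rewrite km.
have csE : \sum_(0 <= k < m.+1) rnorm (c k) ^+ 2 =
    rnorm (c 0%N) ^+ 2 + \sum_(0 <= k < m.+1) rnorm (b k) ^+ 2.
  rewrite !big_nat_recl //= /rnorm normr0 expr0n add0r; congr (_ + _).
  by apply: eq_big_nat => k /andP[_ km]; rewrite km.
set C := \sum_(0 <= k < m.+1) rnorm (c k) ^+ 2 in csE *.
set B := \sum_(0 <= k < m.+1) rnorm (b k) ^+ 2 in csE.
have B0 : 0 <= B by apply: sumr_ge0 => k _; exact: sqr_ge0.
rewrite psiE; apply/andP; split; last first.
  apply: le_trans (rnorm_sqrD_le _ _) _; have /andP[_] := rs m.+1 b; rewrite -/B.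
  rewrite rnormZ exprMn csE; have := sqr_ge0 (rnorm y); have := sqr_ge0 (rnorm (c 0%N)).
  set s := rnorm (c 0%N) ^+ 2; set t := rnorm y ^+ 2; set u := rnorm _ ^+ 2.
  by move=> s0 t0 h; nra.
pose N := (n + m.+1)%N; pose x k := c 0%N * d k + b k.
have xE : c 0%N *: y + \sum_(0 <= k < m.+1) b k *: phi k = \sum_(0 <= k < N) x k *: phi k.
  rewrite /y -(sum_pad _ (leq_addr m.+1 n)) -/N -(sum_pad _ (leq_addl n m.+1)) -/N.
  rewrite scaler_sumr -big_split; apply: eq_bigr => k _ /=; rewrite /x scalerDl -scalerA.
  congr (_ *: _ + _); case: ltnP => // h; first by rewrite dn // scale0r.
  by case: k h => // k h; rewrite /b leqNgt h scale0r.
have [+ _] := andP (rs N x); rewrite xE; set X := rnorm _ ^+ 2.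
set S := \sum_(0 <= k < N) rnorm (x k) ^+ 2 => SX.
(* The term of index 0 alone suffices: [b 0 = 0], so [x 0 = c 0 * d 0]. *)
have cS : rnorm (c 0%N) ^+ 2 * rnorm (d 0%N) ^+ 2 <= S.
  rewrite /S /N addnS big_nat_recl // -exprMn -rnormM /x addr0 lerDl.
  by apply: sumr_ge0 => k _; exact: sqr_ge0.
have BS : B <= 2 * S + 2 * rnorm (c 0%N) ^+ 2 * Y.
  rewrite /B /Y -(sum_pad _ (leq_addr m.+1 n)) -/N -(sum_pad _ (leq_addl n m.+1)) -/N.
  rewrite /S !mulr_sumr -big_split /=; apply: ler_sum => k _.
  have -> : (if (k < n)%N then rnorm (d k) ^+ 2 else 0) = rnorm (d k) ^+ 2.
    by case: ltnP => // h; rewrite dn // /rnorm normr0 expr0n.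
  apply: (@le_trans _ _ (rnorm (b k) ^+ 2)).
    by case: ifP => // _; exact: sqr_ge0.
  have -> : b k = x k + - (c 0%N * d k) by rewrite /x addrC addKr.
  apply: le_trans (rnormC_sqrD_le _ _) _.
  by rewrite -mulrA -exprMn -rnormM /rnorm normrN.
have CK : C <= K * S.
  rewrite csE /K mulrDl mulrAC.
  have : rnorm (c 0%N) ^+ 2 <= S / rnorm (d 0%N) ^+ 2 by rewrite ler_pdivlMr.
  rewrite -mulrA; set s := rnorm (c 0%N) ^+ 2 in cS BS *; set t := S / _ => st.
  have : (1 + 2 * Y) * s <= (1 + 2 * Y) * t by rewrite ler_wpM2l //; lra.
  lra.
apply: le_trans SX; rewrite -mulrA ler_pM2l // mulrC ler_pdivrMr // mulrC.
exact: CK.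
Qed.

(** * The rotated sequence *)

Section Rotation.
Variables (e : nat -> H) (al be q r : R).
Hypotheses (al0 : 0 < al) (be0 : 0 < be) (q0 : 0 < q) (r0 : 0 < r).
Hypothesis qr1 : q ^+ 2 + r ^+ 2 = 1.
Hypothesis e_bounds : forall n c, al * \sum_(0 <= k < n) rnorm (c k) ^+ 2 <=
    rnorm (\sum_(0 <= k < n) c k *: e k) ^+ 2 <=
    be * \sum_(0 <= k < n) rnorm (c k) ^+ 2.

Let r1 : r < 1.
Proof.
rewrite -(@ltr_pXn2r _ 2) ?nnegrE ?(ltW r0) // expr1n -qr1.
by have := exprn_gt0 2 q0; lra.
Qed.

(** [tail_vector k] is [s_k] of the header; [rotated] is [s_0, psi_0, psi_1, ...]. *)
Definition tail_vector k : H :=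
  limn (series (fun m => (q * r ^+ m)%:C *: e (k + m)%N)).

Definition rotated k : H :=
  if k is k'.+1 then r%:C *: e k' - q%:C *: tail_vector k else tail_vector 0.

Lemma rnorm_basis_le k : rnorm (e k) <= Num.sqrt be.
Proof.
rewrite -(@ler_pXn2r _ 2) ?nnegrE ?rnorm_ge0 ?sqrtr_ge0 // sqr_sqrtr ?(ltW be0) //.
have /andP[_] := e_bounds k.+1 (fun j => (j == k)%:R).
rewrite !big_nat_recr //= eqxx scale1r.
have -> : \sum_(0 <= j < k) (j == k)%:R *: e j = 0.
  rewrite big1_seq // => j /andP[_]; rewrite mem_index_iota => /andP[_ jk].
  by rewrite ltn_eqF // scale0r.
have -> : \sum_(0 <= j < k) rnorm ((j == k)%:R : R[i]) ^+ 2 = 0.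
  rewrite big1_seq // => j /andP[_]; rewrite mem_index_iota => /andP[_ jk].
  by rewrite ltn_eqF // /rnorm normr0 expr0n.
by rewrite !add0r /rnorm normr1 expr1n mulr1.
Qed.

Lemma cvgn_tail_vector k :
  series (fun m => (q * r ^+ m)%:C *: e (k + m)%N) @ \oo --> tail_vector k.
Proof.
suff: cvgn (series (fun m => (q * r ^+ m)%:C *: e (k + m)%N)) by [].
apply: (@cvgn_series_dominated _ _ _ 0 (geometric (q * Num.sqrt be) r)).
  move=> m n; rewrite expr1; apply: le_trans (rnorm_sum _ _ _) _.
  apply: ler_sum => j _.
  have qr0 : 0 <= q * r ^+ j by rewrite mulr_ge0 ?exprn_ge0 ?(ltW q0) ?(ltW r0).
  rewrite rnormZr //; apply: le_trans (ler_wpM2l qr0 (rnorm_basis_le _)) _.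
  by rewrite /geometric /= mulrAC.
by apply: is_cvg_geometric_series; rewrite ger0_norm ?ltW.
Qed.

Lemma tail_vectorS k : tail_vector k = q%:C *: e k + r%:C *: tail_vector k.+1.
Proof.
have c : (q%:C *: e k + r%:C *: series (fun m => (q * r ^+ m)%:C *: e (k.+1 + m)%N) n
    @[n --> \oo] --> q%:C *: e k + r%:C *: tail_vector k.+1).
  by apply: cvgD; [exact: cvg_cst|apply: cvgZr; exact: cvgn_tail_vector].
rewrite -(cvg_lim (@norm_hausdorff _ H) c); apply/esym.
apply: (cvg_lim (@norm_hausdorff _ H)).
have := @cvgn_tail_vector k; rewrite -cvg_shiftS.
move=> c'; rewrite (_ : (fun n => _) = (fun n =>
  series (fun m => (q * r ^+ m)%:C *: e (k + m)%N) n.+1)) //.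
apply: funext => n; rewrite /series /= big_nat_recl // expr0 mulr1 addn0; congr (_ + _).
rewrite scaler_sumr; apply: eq_bigr => m _; rewrite scalerA -rmorphM /=.
by rewrite exprS mulrCA addnS addSn.
Qed.

(** The coefficients [q * r ^+ j] of [tail_vector n] have squares summing to 1, and they sit at
    indices from [n] on. So [tail_vector n] behaves in the Riesz bounds like one further basis
    vector; truncate and pass to the limit. *)
Lemma tail_bounds n (b : nat -> R[i]) (a : R[i]) :
  al * (\sum_(0 <= k < n) rnorm (b k) ^+ 2 + rnorm a ^+ 2) <=
  rnorm (\sum_(0 <= k < n) b k *: e k + a *: tail_vector n) ^+ 2 <=
  be * (\sum_(0 <= k < n) rnorm (b k) ^+ 2 + rnorm a ^+ 2).
Proof.
set Q := \sum_(0 <= k < n) _; set X := \sum_(0 <= k < n) _.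
pose v m := X + a *: series (fun j => (q * r ^+ j)%:C *: e (n + j)%N) m.
pose c k : R[i] := if (k < n)%N then b k else a * (q * r ^+ (k - n))%:C.
have vE m : v m = \sum_(0 <= k < n + m) c k *: e k.
  rewrite (@big_cat_nat _ _ _ n) ?leq_addr //=; congr (_ + _).
    by apply: eq_big_nat => k /andP[_ kn]; rewrite /c kn.
  rewrite sum_shift scaler_sumr; apply: eq_bigr => j _.
  by rewrite /c ltnNge leq_addr /= addKn scalerA.
have geoE m : \sum_(0 <= j < m) (q * r ^+ j) ^+ 2 = 1 - r ^+ (2 * m).
  elim: m => [|m IH]; first by rewrite big_geq // muln0 expr0 subrr.
  have q2 : q ^+ 2 = 1 - r ^+ 2 by rewrite -qr1 addrK.
  by rewrite big_nat_recr //= IH exprMn -exprM (mulnC m) q2 mulnS exprD; ring.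
have QE m : \sum_(0 <= k < n + m) rnorm (c k) ^+ 2 =
    Q + rnorm a ^+ 2 * (1 - r ^+ (2 * m)).
  rewrite (@big_cat_nat _ _ _ n) ?leq_addr //=; congr (_ + _).
    by apply: eq_big_nat => k /andP[_ kn]; rewrite /c kn.
  rewrite sum_shift -geoE mulr_sumr; apply: eq_bigr => j _.
  rewrite /c ltnNge leq_addr /= addKn rnormM exprMn rnorm_real //.
  by rewrite mulr_ge0 ?exprn_ge0 ?(ltW q0) ?(ltW r0).
have cv : (rnorm (v m) ^+ 2 @[m --> \oo] --> rnorm (X + a *: tail_vector n) ^+ 2).
  have c1 : v m @[m --> \oo] --> X + a *: tail_vector n.
    by apply: cvgD; [exact: cvg_cst|apply: cvgZr; exact: cvgn_tail_vector].
  rewrite expr2; under eq_cvg do rewrite expr2.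
  by apply: cvgM; exact: cvgn_rnorm c1.
have c0 : (r ^+ (2 * m) @[m --> \oo] --> (0 : R)).
  under eq_cvg do rewrite exprM; apply: cvg_expr.
  by rewrite ger0_norm ?sqr_ge0 // exprn_ilt1 // ltW.
apply/andP; split.
  have c1 : (al * (Q + rnorm a ^+ 2 * (1 - r ^+ (2 * m))) @[m --> \oo] -->
      al * (Q + rnorm a ^+ 2 * (1 - 0))).
    apply: cvgMr; apply: cvgD; first exact: cvg_cst.
    by apply: cvgMr; apply: cvgB => //; exact: cvg_cst.
  move: c1; rewrite subr0 mulr1 => c1.
  apply: (ler_cvg_to c1 cv); apply: nearW => m.
  by rewrite -QE vE; have /andP[] := e_bounds (n + m) c.
apply: (cvgr_to_le cv); apply: nearW => m; rewrite vE.
have /andP[_ /le_trans] := e_bounds (n + m) c; apply.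
rewrite ler_pM2l // QE lerD2l ler_piMr ?sqr_ge0 // gerBl.
by rewrite exprn_ge0 // ltW.
Qed.

(** Induction, carrying a single tail term: adding [d *: rotated n.+1] to [a *: tail_vector n] gives
    [e n] the coefficient [a q + d r] and [tail_vector n.+1] the coefficient [a r - d q]. This is a
    rotation of [(a, d)], so the sum of squares is preserved. *)
Lemma rotated_sum n (c : nat -> R[i]) : exists b a,
  \sum_(0 <= k < n.+1) c k *: rotated k =
    \sum_(0 <= k < n) b k *: e k + a *: tail_vector n /\
  \sum_(0 <= k < n.+1) rnorm (c k) ^+ 2 =
    \sum_(0 <= k < n) rnorm (b k) ^+ 2 + rnorm a ^+ 2.
Proof.
elim: n => [|n [b [a [IH1 IH2]]]].
  by exists (fun=> 0), (c 0%N); rewrite !big_nat1 !big_geq // !add0r.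
set d := c n.+1.
exists (fun k => if (k < n)%N then b k else a * q%:C + d * r%:C), (a * r%:C - d * q%:C).
rewrite !(big_nat_recr n.+1) //= IH1 IH2 !(big_nat_recr n) //= ltnn -/d -!addrA.
split; congr (_ + _); try by apply: eq_big_nat => k /andP[_ ->].
  rewrite tail_vectorS scalerDr scalerBr !scalerA scalerDl scalerBl.
  by rewrite addrACA -!addrA; congr (_ + _); rewrite addrCA.
rewrite !rnorm_sqrC; case: (a) (d) => [a1 a2] [d1 d2] /=.
have q2 : q ^+ 2 = 1 - r ^+ 2 by rewrite -qr1 addrK.
by ring: q2.
Qed.

Lemma rotated_riesz : riesz_sequence rotated.
Proof.
exists al, be; split=> // -[|n] c.
  by rewrite !big_geq // rnorm0 !mulr0 expr0n lexx.
by have [b [a [-> ->]]] := rotated_sum n c; exact: tail_bounds.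
Qed.

(** Start from [tail_vector 0], which is [rotated 0], and apply the inverse rotation repeatedly:
    [tail_vector j] and [rotated j.+1] yield [e j] and [tail_vector j.+1]. *)
Lemma rotated_complete : complete_sequence e -> complete_sequence rotated.
Proof.
move=> ec; apply: (complete_sequence_span ec) => k.
have step j : in_span rotated (tail_vector j) ->
    in_span rotated (e j) /\ in_span rotated (tail_vector j.+1).
  move=> sj; have qrC : q%:C ^+ 2 + r%:C ^+ 2 = 1 :> R[i].
    by rewrite -!rmorphXn -rmorphD /= qr1.
  split.
    have -> : e j = q%:C *: tail_vector j + r%:C *: rotated j.+1.
      rewrite /rotated (tail_vectorS j) scalerDr scalerBr !scalerA (mulrC r%:C q%:C).
      by rewrite addrACA subrr addr0 -scalerDl -!expr2 qrC scale1r.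
    by apply: in_spanD; apply: in_spanZ => //; exact: in_span_id.
  have -> : tail_vector j.+1 = r%:C *: tail_vector j + (- q%:C) *: rotated j.+1.
    rewrite /rotated (tail_vectorS j) scalerDr scalerBr scaleNr !scalerA (mulrC r%:C q%:C).
    rewrite addrACA mulNr scaleNr subrr add0r opprK -scalerDl.
    by rewrite -!expr2 addrC qrC scale1r.
  by apply: in_spanD; apply: in_spanZ => //; exact: in_span_id.
suff /step[] : in_span rotated (tail_vector k) by [].
by elim: k => [|k /step[]//]; exact: (in_span_id rotated 0).
Qed.

Lemma rotated_dist k : rnorm (e k - rotated k.+1) <= (1 - r + q) * Num.sqrt be.
Proof.
have -> : e k - rotated k.+1 = (1 - r)%:C *: e k + q%:C *: tail_vector k.+1.
  by rewrite /= opprB addrCA addrC rmorphB /= scalerBl scale1r.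
apply: le_trans (rnormD _ _) _.
have tle : rnorm (tail_vector k.+1) <= Num.sqrt be.
  rewrite -(@ler_pXn2r _ 2) ?nnegrE ?rnorm_ge0 ?sqrtr_ge0 // sqr_sqrtr ?(ltW be0) //.
  have /andP[_] := tail_bounds k.+1 (fun=> 0) 1.
  rewrite big1 => [|j _]; last by rewrite scale0r.
  rewrite big1 => [|j _]; last by rewrite /rnorm normr0 expr0n.
  by rewrite !add0r scale1r /rnorm normr1 expr1n mulr1.
rewrite !rnormZr ?subr_ge0 ?(ltW r1) ?(ltW q0) // [leRHS]mulrDl lerD //.
  by rewrite ler_wpM2l ?rnorm_basis_le // subr_ge0 ltW.
by rewrite ler_wpM2l // ltW.
Qed.

End Rotation.

(** * Making room for one vector *)

Lemma riesz_shift_approximation e (eps : R) :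
  riesz_sequence e -> complete_sequence e -> 0 < eps ->
  exists phi, [/\ riesz_sequence phi, complete_sequence phi &
    forall k, rnorm (e k - phi k.+1) <= eps].
Proof.
move=> [al [be [al0 be0 eb]]] ec eps0; set s := Num.sqrt be.
have s0 : 0 < s by rewrite sqrtr_gt0.
(* The distance is at most [(1 - r + q) * s]. Since [r <= 1], [1 - r <= 1 - r ^+ 2 = q ^+ 2 <= q],
   so [2 * q * s <= eps] suffices; the bound 1/2 keeps [r] positive. *)
pose q := Num.min (1 / 2) (eps / (2 * s)).
have q0 : 0 < q by rewrite lt_min !divr_gt0 // mulr_gt0.
have q1 : q <= 1 / 2 by rewrite ge_min lexx.
pose r := Num.sqrt (1 - q ^+ 2).
have q2 : q ^+ 2 <= q by rewrite expr2 ler_piMr ?(ltW q0) //; lra.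
have rr : r ^+ 2 = 1 - q ^+ 2 by rewrite sqr_sqrtr //; lra.
have r0 : 0 < r by rewrite sqrtr_gt0; lra.
have qr1 : q ^+ 2 + r ^+ 2 = 1 by rewrite rr addrCA subrr addr0.
exists (rotated e q r); split; first exact: (rotated_riesz al0 be0 q0 r0 qr1 eb).
  exact: (rotated_complete be0 q0 r0 qr1 eb).
move=> k; apply: le_trans (rotated_dist be0 q0 r0 qr1 eb k) _.
have r1 : r <= 1 by rewrite -[leRHS]sqrtr1 ler_wsqrtr // gerBl sqr_ge0.
have rq : 1 - r <= q.
  have : r ^+ 2 <= r by rewrite expr2 ler_piMr ?(ltW r0).
  lra.
apply: (@le_trans _ _ (2 * q * s)); first by rewrite ler_wpM2r ?(ltW s0) //; lra.
rewrite mulrAC -ler_pdivlMl ?mulr_gt0 // mulrC.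
by rewrite /q ge_min lexx orbT.
Qed.

Lemma riesz_cons_approximation e (f : H) (eps : R) :
  riesz_sequence e -> complete_sequence e -> 0 < eps ->
  exists psi, [/\ riesz_sequence psi, complete_sequence psi,
    rnorm (f - psi 0%N) <= eps & forall k, rnorm (e k - psi k.+1) <= eps].
Proof.
move=> er ec eps0; have [phi [pr pc ephi]] := riesz_shift_approximation er ec eps0.
have /(pc f)[n [c fc]] : 0 < eps / 2 by rewrite divr_gt0.
(* Small enough that [tau * rnorm (phi 0)] is at most [eps / 2], even when added to a vanishing
   coefficient; the 1 keeps the denominator positive. *)
pose tau := eps / 2 / (1 + rnorm (phi 0%N)).
have tau0 : 0 < tau by rewrite !divr_gt0 // ltr_pwDl ?rnorm_ge0.
(* The combination may be empty ([n = 0]); padding then makes its coefficient on [phi 0] equal to 0,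
   whatever [c 0] is. *)
pose pad k : R[i] := if (k < n)%N then c k else 0.
pose t : R := if pad 0%N == 0 then tau else 0.
pose d k : R[i] := if k is 0 then pad 0%N + t%:C else pad k.
have d0 : d 0%N != 0.
  rewrite /d /t; have [->|p0] := eqVneq (pad 0%N) 0; last by rewrite addr0.
  by rewrite add0r gt_eqF // ltcR.
have dn k : (n.+1 <= k)%N -> d k = 0.
  by case: k => // k nk; rewrite /d /pad ltnNge (ltnW nk).
have [psir psic] := riesz_sequence_replace pr pc dn d0.
eexists; split; [exact: psir|exact: psic| |exact: ephi].
have -> : \sum_(0 <= j < n.+1) d j *: phi j =
    \sum_(0 <= j < n) c j *: phi j + t%:C *: phi 0%N.
  rewrite -(sum_pad _ (leqnSn n)) !big_nat_recl //= /pad scalerDl addrAC.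
  congr (_ + _ + _); first by case: ifP => // _; rewrite scale0r.
  by apply: eq_bigr => k _; case: ifP => // _; rewrite scale0r.
rewrite opprD addrA; apply: le_trans (rnormD _ _) _; rewrite rnormN.
have t0 : 0 <= t by rewrite /t; case: ifP => // _; exact: ltW.
have tt : t <= tau by rewrite /t; case: ifP => // _; exact: ltW.
rewrite rnormZr // (splitr eps) lerD //.
have := rnorm_ge0 (phi 0%N); set x := rnorm _ => x0.
apply: (@le_trans _ _ (tau * x)); first exact: ler_wpM2r.
rewrite /tau -mulrA ler_piMr ?divr_ge0 ?(ltW eps0) // mulrC ler_pdivrMr; lra.
Qed.

Lemma riesz_basis_cons_approximation e (f : H) (eps : R) :
  riesz_basis dot e -> 0 < eps -> exists psi, [/\ riesz_basis dot psi,
    rnorm (f - psi 0%N) <= eps & forall k, rnorm (e k - psi k.+1) <= eps].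
Proof.
move=> /riesz_basis_sequence[er ec] eps0.
have [psi [pr pc fpsi epsi]] := riesz_cons_approximation f er ec eps0.
by exists psi; split=> //; exact: riesz_sequence_basis.
Qed.

End Frames.

(** * Induction on the number of extra vectors *)

Theorem theorem3p4 (R : realType) (H : completeNormedModType R[i])
    (dot : {dot H for Num.conj}) (dot_norm : inner_norm dot)
    (H_separable : separable H) (H_infinite_dim : ~ finite_dimensional H)
    (g : nat -> H) (N : nat) (N_gt0 : (0 < N)%N)
    (g_frame : frame dot g)
    (g_tail_riesz : riesz_basis dot (fun k => g (N + k)%N))
    (delta : R) (delta_gt0 : 0 < delta) :
  exists psi : nat -> H,
    riesz_basis dot psi /\ forall k : nat, rnorm (g k - psi k) <= delta.
Proof.
clear N_gt0 g_frame H_separable H_infinite_dim.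
(* Both [g] and [delta] vary: each step changes the sequence and spends half of the tolerance. *)
elim: N g delta delta_gt0 g_tail_riesz => [|N IH] g delta delta_gt0 g_tail_riesz.
  by exists g; split=> [//|k]; rewrite subrr rnorm0 ltW.
have d2 : 0 < delta / 2 by rewrite divr_gt0.
have [phi [phir gphi tphi]] := riesz_basis_cons_approximation dot_norm (g N) g_tail_riesz d2.
(* The last extra vector [g N] and the Riesz basis after it are replaced by [phi], so [g'] has one
   extra vector fewer. *)
pose g' k := if (k < N)%N then g k else phi (k - N)%N.
have g'tail : (fun k => g' (N + k)%N) = phi.
  by apply: funext => k; rewrite /g' ltnNge leq_addr /= addKn.
have [|psi [psir g'psi]] := IH g' _ d2; first by rewrite g'tail.
exists psi; split=> // k.
rewrite -(subrK (g' k) (g k)) -addrA (splitr delta).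
apply: le_trans (rnormD _ _) (lerD _ (g'psi k)).
rewrite /g'; case: ltnP => [_|]; first by rewrite subrr rnorm0 ltW.
rewrite leq_eqVlt => /predU1P[<-|Nk]; first by rewrite subnn.
have -> : k = (N.+1 + (k - N.+1))%N by rewrite subnKC.
by rewrite addSnnS addKn -addSnnS.
Qed.
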